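(* Let $k,n_1,n_2,n_3\ge 2$ be integers, let $G=P_{n_1}\Box P_{n_2}\Box P_{n_3}$, and let $\alpha_m=2(n_1+n_2+n_3)-8$ and $\alpha_M=\min\{n_1(n_2+n_3-2),\,n_2(n_1+n_3-2),\,n_3(n_1+n_2-2)\}$. (1) If $2\le k<\alpha_m$, then $\dim_{k+1}(G)=2k+2$ if $k$ is odd and $\dim_{k+1}(G)=2k+3$ if $k$ is even. (2) If $\alpha_m\le k<\alpha_M$, then $G$ has a $(k+1)$-resolving set and $\dim_{k+1}(G)\le n_1n_2n_3-(n_1-2)(n_2-2)(n_3-2)$. (3) If $\alpha_M\le k$, then $G$ has no $(k+1)$-resolving set.
   Context: $P_{n_1}\Box P_{n_2}\Box P_{n_3}$ is the grid graph with vertex set $\{(x_1,x_2,x_3): 0\le x_i\le n_i-1\}$, two vertices adjacent iff they differ by exactly $1$ in exactly one coordinate; distance is $d(x,y)=\sum_i|x_i-y_i|$. For an ordered set $S=\{u_1,\dots,u_t\}$ of vertices, $r(x|S)=(d(x,u_1),\dots,d(x,u_t))$. A set $S$ is a $k$-resolving set if for every pair of distinct vertices $x,y$ the vectors $r(x|S)$ and $r(y|S)$ differ in at least $k$ coordinates (equivalently, every pair of distinct vertices is resolved, i.e. has different distances, by at least $k$ vertices of $S$). When a $k$-resolving set exists, $\dim_k(G)$ denotes the minimum cardinality of a $k$-resolving set. *)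

(* Defs.v *)
From mathcomp Require Import all_boot zify.

Set Implicit Arguments.
Unset Strict Implicit.
Unset Printing Implicit Defensive.

(* A finite simple graph is a symmetric irreflexive relation on a finType. *)

Definition path_graph (n : nat) : rel 'I_n :=
  [rel i j : 'I_n | (i.+1 == j) || (j.+1 == i)].

Definition cart_prod (T U : finType) (e : rel T) (f : rel U) : rel (T * U) :=
  [rel x y : T * U | e x.1 y.1 && (x.2 == y.2) || (x.1 == y.1) && f x.2 y.2].

Definition grid3 (n1 n2 n3 : nat) : rel ('I_n1 * 'I_n2 * 'I_n3) :=
  cart_prod (cart_prod (@path_graph n1) (@path_graph n2)) (@path_graph n3).

(* Shortest paths have length less than #|T|; when y is not reachable from x
   the value is the default #|T|. *)
Definition gdist (T : finType) (e : rel T) (x y : T) : nat :=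
  find (fun m => [exists p : m.-tuple T, path e x p && (last x p == y)])
       (iota 0 #|T|).

Definition k_resolving (T : finType) (e : rel T) (k : nat) (S : {set T}) :=
  forall x y : T, x != y ->
    k <= #|[set u in S | gdist e x u != gdist e y u]|.

(* "dim_k of the graph e is defined and equal to d". *)
Definition k_dim_is (T : finType) (e : rel T) (k d : nat) :=
  (exists2 S : {set T}, k_resolving e k S & #|S| = d) /\
  (forall S : {set T}, k_resolving e k S -> d <= #|S|).

(* |i - j|, via truncated subtraction. *)
Definition absdiff (i j : nat) : nat := (i - j) + (j - i).

Lemma path_graph_sym n : symmetric (@path_graph n).
Proof. by move=> i j; rewrite /path_graph /= orbC. Qed.

Lemma path_graph_irr n : irreflexive (@path_graph n).
Proof. by move=> i; rewrite /path_graph /= orbb eqn_leq ltnn. Qed.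

Lemma cart_prod_sym (T U : finType) (e : rel T) (f : rel U) :
  symmetric e -> symmetric f -> symmetric (cart_prod e f).
Proof.
by move=> se sf x y; rewrite /cart_prod /= se sf [x.1 == _]eq_sym [x.2 == _]eq_sym.
Qed.

Lemma cart_prod_irr (T U : finType) (e : rel T) (f : rel U) :
  irreflexive e -> irreflexive f -> irreflexive (cart_prod e f).
Proof. by move=> ie jf x; rewrite /cart_prod /= ie jf andbF. Qed.

Lemma grid3_sym n1 n2 n3 : symmetric (@grid3 n1 n2 n3).
Proof. by do !apply: cart_prod_sym; apply: path_graph_sym. Qed.

Lemma grid3_irr n1 n2 n3 : irreflexive (@grid3 n1 n2 n3).
Proof. by do !apply: cart_prod_irr; apply: path_graph_irr. Qed.

Definition walk_metric (T : finType) (e : rel T) (d : T -> T -> nat) :=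
  [/\ forall x y, (d x y == 0) = (x == y),
      forall x y z, e x z -> d x y <= (d z y).+1 &
      forall x y, 0 < d x y -> exists2 z, e x z & d x y = (d z y).+1].

Lemma walk_metric_gdist (T : finType) (e : rel T) d :
  walk_metric e d -> forall x y, gdist e x y = d x y.
Proof.
case=> d0 dle dS x y.
have lb p u : path e u p -> last u p = y -> d u y <= size p.
  elim: p u => [|z p IHp] u /=; first by move=> _ ->; rewrite leqn0 d0.
  by case/andP=> euz pz lz; apply: leq_trans (dle _ _ _ euz) _; rewrite ltnS IHp.
have ub m u : d u y = m ->
    exists2 p, path e u p & last u p = y /\ size p = m.
  elim: m u => [|m IHm] u du.
    by exists [::] => //; split=> //; apply/eqP; rewrite -d0 du.
  have [|z euz] := dS u y; first by rewrite du.
  rewrite du => -[dz]; have [p pz [lz sz]] := IHm z (esym dz).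
  by exists (z :: p) => /=; [rewrite euz | split=> //; rewrite sz].
have [p px [lx sx]] := ub _ x erefl.
have lt_d : d x y < #|T|.
  case/shortenP: px lx => q qx uq _ lq.
  apply: leq_ltn_trans (lb _ _ qx lq) _.
  by rewrite -[(size q).+1]/(size (x :: q)) -(card_uniqP uq) max_card.
rewrite /gdist; set P := fun m => _.
have Pd : P (d x y).
  have sp : size p == d x y by apply/eqP.
  by apply/existsP; exists (Tuple sp) => /=; rewrite px lx eqxx.
have le_d : find P (iota 0 #|T|) <= d x y.
  rewrite leqNgt; apply/negP=> /(before_find 0).
  by rewrite nth_iota // add0n Pd.
apply/eqP; rewrite eqn_leq le_d /=.
have hasP : has P (iota 0 #|T|).
  by rewrite has_find size_iota (leq_ltn_trans le_d).
have := nth_find 0 hasP; rewrite nth_iota ?(leq_ltn_trans le_d) // add0n.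
case/existsP=> q /andP[qx /eqP lq].
by rewrite -[X in _ <= X](size_tuple q) lb.
Qed.

Lemma path_graph_metric n :
  walk_metric (@path_graph n) (fun i j => absdiff i j).
Proof.
rewrite /absdiff; split=> [i j|i j k|i j].
- by rewrite addn_eq0 !subn_eq0 -eqn_leq.
- by rewrite /path_graph /=; lia.
case: (ltngtP i j) => [lt_ij _|lt_ji _|/val_inj->]; last by rewrite subnn.
- have lt_n : i.+1 < n := leq_ltn_trans lt_ij (ltn_ord j).
  by exists (Ordinal lt_n); rewrite /path_graph /=; [rewrite eqxx | lia].
have lt_n : i.-1 < n := leq_ltn_trans (leq_pred i) (ltn_ord i).
by exists (Ordinal lt_n); rewrite /path_graph /=; lia.
Qed.

Lemma cart_prod_metric (T U : finType) (e : rel T) (f : rel U) d d' :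
  walk_metric e d -> walk_metric f d' ->
  walk_metric (cart_prod e f) (fun x y => d x.1 y.1 + d' x.2 y.2).
Proof.
case=> d0 dle dS [d'0 d'le d'S];
split=> [[a b] [a' b']|[a b] [a' b'] [u v]|[a b] [a' b']] /=.
- by rewrite addn_eq0 d0 d'0.
- rewrite /cart_prod /=; case/orP=> /andP[].
    by move=> eau /eqP->; rewrite -addSn leq_add2r dle.
  by move=> /eqP-> fbv; rewrite -addnS leq_add2l d'le.
case: (posnP (d a a')) => [da0|/dS[u eau ->] _].
  rewrite da0 => /d'S[v fbv ->].
  by exists (a, v); rewrite /cart_prod /= ?da0 ?eqxx ?fbv ?orbT.
by exists (u, b); rewrite /cart_prod /= ?eqxx ?eau.
Qed.

Lemma gdist_grid3 n1 n2 n3 (x y : 'I_n1 * 'I_n2 * 'I_n3) :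
  gdist (@grid3 n1 n2 n3) x y =
  absdiff x.1.1 y.1.1 + absdiff x.1.2 y.1.2 + absdiff x.2 y.2.
Proof.
have M12 := cart_prod_metric (@path_graph_metric n1) (@path_graph_metric n2).
exact: walk_metric_gdist (cart_prod_metric M12 (@path_graph_metric n3)) x y.
Qed.

(* Main.v *)
(* Write d(x,u) - d(y,u) as a sum of three terms, one per axis.  Moving u from one
   end of an axis to the other negates the term of that axis, which at the ends is
   nonzero if x and y differ there; so one of the two positions of u resolves x
   and y.  Hence a set of vertices closed under these moves, each of them at an end
   of some axis where x and y differ, resolves x and y by at least half of its
   elements.  For (1) such a set consists of corners and inner edge vertices of the
   box (minus one vertex if k + 1 is odd), for (2) it is contained in the surface.
   If x and y differ on one axis only, all layers but at most one resolve them.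

   For the lower bounds, the two diagonals of the unit square at the origin in the
   axes i and j are resolved by u only if u_i and u_j are both zero or both nonzero,
   respectively only if exactly one of them is zero.  So a k-resolving set has at
   least 2k elements, and k is at most the number of vertices of the second kind. *)

Require Import Defs.
From mathcomp Require Import all_boot zify.

Set Implicit Arguments.
Unset Strict Implicit.
Unset Printing Implicit Defensive.

(** * Ends, reflections and midpoints on one axis *)

Section Ends.
Variable n : nat.

Definition ends : {set 'I_n} := [set i : 'I_n | (i == 0 :> nat) || (i.+1 == n)].

(** Inner positions stay fixed, which makes [flip] an involution of the whole axis. *)
Definition flip (i : 'I_n) : 'I_n := if i \in ends then rev_ord i else i.

Lemma flip_ends i : (flip i \in ends) = (i \in ends).
Proof.
rewrite /flip; case: ifP => // iE; move: iE (ltn_ord i).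
by rewrite !inE /=; lia.
Qed.

Lemma flipK : involutive flip.
Proof.
by move=> i; rewrite {1}/flip flip_ends; case: ifP => iE; rewrite /flip iE ?rev_ordK.
Qed.

(** Every [x] lies between [u] and the opposite end, so the two distances add up to the length of
    the path. Hence [flip] negates a difference of two distances to [u]. *)
Lemma absdiff_flip (x u : 'I_n) :
  u \in ends -> absdiff x (flip u) + absdiff x u = n.-1.
Proof.
move=> uE; rewrite /flip uE; move: uE (ltn_ord x) (ltn_ord u).
by rewrite inE /absdiff /=; lia.
Qed.

Lemma absdiff_ends_inj (u : 'I_n) :
  u \in ends -> injective (fun x : 'I_n => absdiff x u).
Proof.
move=> uE x y; move: uE (ltn_ord x) (ltn_ord y) (ltn_ord u).
by rewrite inE /absdiff => *; apply/val_inj => /=; lia.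
Qed.

(** The cut at [n.-1] keeps the last end out for every [a], so that [inner_uptoN] holds without a
    bound on [a]. *)
Definition inner_upto a : {set 'I_n} := [set i : 'I_n | 0 < i < minn a.+1 n.-1].

Lemma inner_uptoN a i : i \in inner_upto a -> i \notin ends.
Proof. by rewrite !inE; lia. Qed.

Definition midpoint (x y : 'I_n) : {set 'I_n} := [set i : 'I_n | i + i == x + y].

Lemma card_midpoint x y : #|midpoint x y| <= 1.
Proof.
apply/card_le1_eqP => i j; rewrite !inE => /eqP hi /eqP hj.
by apply/val_inj => /=; lia.
Qed.

(** Distinct points of a path are equidistant only from the point halfway between them, which is an
    inner one. *)
Lemma midpointP (x y u : 'I_n) :
  x != y -> absdiff x u = absdiff y u -> u \in midpoint x y :\: ends.
Proof.
rewrite -val_eqE !inE /absdiff /= => neq; move: (ltn_ord x) (ltn_ord y); lia.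
Qed.

Hypothesis n_ge2 : 2 <= n.

Lemma card_ends : #|ends| = 2.
Proof.
have n_gt0 : 0 < n by lia.
have n_gt1 : n.-1 < n by lia.
have -> : ends = [set Ordinal n_gt0; Ordinal n_gt1].
  apply/setP => i; rewrite !inE -!val_eqE /=; move: (ltn_ord i); lia.
by rewrite cards2 -val_eqE /=; case: eqP => //; lia.
Qed.

Lemma card_inner : #|~: ends| = n - 2.
Proof. by have := cardsC ends; rewrite card_ends card_ord; lia. Qed.

Lemma card_inner_upto a : a <= n - 2 -> #|inner_upto a| = a.
Proof.
move=> a_le.
have lt_n (i : 'I_a) : i.+1 < n by move: (ltn_ord i); lia.
have inj_f : injective (fun i => Ordinal (lt_n i)).
  by move=> i j [] /val_inj.
rewrite -[RHS]card_ord -(card_imset _ inj_f); apply: eq_card => j.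
apply/idP/imsetP => [|[i _ ->]]; rewrite inE /=; last by move: (ltn_ord i); lia.
move=> j_in; have j_lt : j.-1 < a by lia.
by exists (Ordinal j_lt) => //; apply: val_inj => /=; lia.
Qed.

End Ends.

(** * Two counting lemmas *)

Lemma card_mesh_arith a b c : 2 <= a -> 2 <= b ->
  a * b * c - (a - 2) * (b - 2) * c = 2 * (c * (a + b - 2)).
Proof.
case: a b => [|[|a]] [|[|b]] // _ _; rewrite -mulnBl !subn2 /= [c * _]mulnC mulnA.
by congr (_ * _); lia.
Qed.

(* If #|S| = 2k then each of A, B, C contains exactly k elements of S; as every
   element lies in none or two of A, B, C, 3k is even. *)
Lemma halved_card (T : finType) (S A B C : {set T}) k :
  (forall u, (u \in C) = (u \in A) (+) (u \in B)) ->
  k <= #|S :&: A| /\ k <= #|S :\: A| ->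
  k <= #|S :&: B| /\ k <= #|S :\: B| ->
  k <= #|S :&: C| /\ k <= #|S :\: C| -> 2 * k + odd k <= #|S|.
Proof.
move=> CE [hA hA'] [hB hB'] [hC hC'].
have cA := cardsID A S; have cB := cardsID B S; have cC := cardsID C S.
have dA := cardsID B (S :&: A); have dB := cardsID A (S :&: B).
have dC := cardsID A (S :&: C).
have e1 : S :&: B :&: A = S :&: A :&: B by rewrite setIAC.
have e2 : S :&: C :&: A = S :&: A :\: B.
  apply/setP => u; rewrite !inE CE.
  by case: (u \in S); case: (u \in A); case: (u \in B).
have e3 : S :&: C :\: A = S :&: B :\: A.
  apply/setP => u; rewrite !inE CE.
  by case: (u \in S); case: (u \in A); case: (u \in B).
move: dA dB dC; rewrite e1 e2 e3; lia.
Qed.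

(** * Vertices resolving a given pair, and the flip argument *)

Section Grid.
Variables n1 n2 n3 : nat.
Hypotheses (n1_ge2 : 2 <= n1) (n2_ge2 : 2 <= n2) (n3_ge2 : 2 <= n3).
Local Notation V := ('I_n1 * 'I_n2 * 'I_n3)%type.
Implicit Types (x y u : V) (Q B : {set V}).

Definition resolvers x y : {set V} :=
  [set u | gdist (@grid3 n1 n2 n3) x u != gdist (@grid3 n1 n2 n3) y u].

Lemma mem_resolvers x y u :
  (u \in resolvers x y) =
  (absdiff x.1.1 u.1.1 + absdiff x.1.2 u.1.2 + absdiff x.2 u.2 !=
   absdiff y.1.1 u.1.1 + absdiff y.1.2 u.1.2 + absdiff y.2 u.2).
Proof. by rewrite inE !gdist_grid3. Qed.

Lemma k_resolvingP k Q :
  k_resolving (@grid3 n1 n2 n3) k Q <->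
  forall x y, x != y -> k <= #|Q :&: resolvers x y|.
Proof.
by split=> kQ x y /kQ; congr (_ <= _); apply: eq_card => u; rewrite !inE.
Qed.

Lemma eq_vertex x y : (x == y) = [&& x.1.1 == y.1.1, x.1.2 == y.1.2 & x.2 == y.2].
Proof. by case: x y => [[? ?] ?] [[? ?] ?]; rewrite !xpair_eqE andbA. Qed.

Lemma mem_setX3 A1 A2 A3 u :
  (u \in setX (setX A1 A2) A3) = (u.1.1 \in A1) && (u.1.2 \in A2) && (u.2 \in A3).
Proof. by case: u => [[a b] c]; rewrite !in_setX. Qed.

Lemma card_setX3 (A1 : {set 'I_n1}) (A2 : {set 'I_n2}) (A3 : {set 'I_n3}) :
  #|setX (setX A1 A2) A3| = #|A1| * #|A2| * #|A3|.
Proof. by rewrite !cardsX. Qed.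

Definition flip1 u : V := (flip u.1.1, u.1.2, u.2).
Definition flip2 u : V := (u.1.1, flip u.1.2, u.2).
Definition flip3 u : V := (u.1.1, u.1.2, flip u.2).

Definition flip_closed Q :=
  forall u, u \in Q -> [/\ flip1 u \in Q, flip2 u \in Q & flip3 u \in Q].

Lemma flip_closed_resolvers x y Q :
  flip_closed Q ->
  {in Q, forall u, [|| (x.1.1 != y.1.1) && (u.1.1 \in ends n1),
                       (x.1.2 != y.1.2) && (u.1.2 \in ends n2) |
                       (x.2 != y.2) && (u.2 \in ends n3)]} ->
  #|Q| <= 2 * #|Q :&: resolvers x y|.
Proof.
move=> clQ endQ.
pose g u := if (x.1.1 != y.1.1) && (u.1.1 \in ends n1) then flip1 u else
            if (x.1.2 != y.1.2) && (u.1.2 \in ends n2) then flip2 u else flip3 u.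
(* [flip] preserves being at an end, so [g] selects the same axis at [u] and at [g u]. *)
have gK : involutive g.
  have f1 u : ((flip1 u).1.1 \in ends n1) = (u.1.1 \in ends n1) := flip_ends _.
  have f2 u : ((flip2 u).1.2 \in ends n2) = (u.1.2 \in ends n2) := flip_ends _.
  move=> u; rewrite {2}/g; case: ifP => h1; last case: ifP => h2.
  - by rewrite /g f1 h1 /flip1 /= flipK; case: u {h1} => [[]].
  - by rewrite /g [(flip2 u).1.1]/= h1 f2 h2 /flip2 /= flipK; case: u {h1 h2} => [[]].
  - by rewrite /g [(flip3 u).1.1]/= h1 [(flip3 u).1.2]/= h2 /flip3 /= flipK;
      case: u {h1 h2} => [[]].
have gQ u : u \in Q -> g u \in Q.
  by move=> /clQ[? ? ?]; rewrite /g; do 2?case: ifP.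
have gR u : u \in Q -> u \notin resolvers x y -> g u \in resolvers x y.
  move=> /endQ uE; rewrite !mem_resolvers negbK => /eqP e1.
  apply/eqP; move: uE e1; rewrite /g /flip1 /flip2 /flip3.
  case: ifP => [/andP[/eqP neq uE] _|_] /=.
    move=> e1 e2; case: neq; apply: (absdiff_ends_inj uE) => /=.
    have := absdiff_flip x.1.1 uE; have := absdiff_flip y.1.1 uE; lia.
  case: ifP => [/andP[/eqP neq uE] _|_ /= /andP[/eqP neq uE]] /=.
    move=> e1 e2; case: neq; apply: (absdiff_ends_inj uE) => /=.
    have := absdiff_flip x.1.2 uE; have := absdiff_flip y.1.2 uE; lia.
  move=> e1 e2; case: neq; apply: (absdiff_ends_inj uE) => /=.
  have := absdiff_flip x.2 uE; have := absdiff_flip y.2 uE; lia.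
set QR := Q :&: resolvers x y.
(* An element of [Q] that does not resolve the pair is the image of its partner, which does. *)
have sub : Q \subset QR :|: g @: QR.
  apply/subsetP => u uQ; rewrite inE [u \in QR]inE uQ /=.
  have [//|uR] := boolP (u \in resolvers x y).
  by apply/imsetP; exists (g u); rewrite ?gK // inE gQ // gR.
apply: leq_trans (subset_leq_card sub) _.
apply: leq_trans (leq_card_setU _ _) _.
by rewrite mul2n -addnn leq_add2l leq_imset_card.
Qed.

Lemma leq_card_resolvers x y Q B :
  Q :\: resolvers x y \subset B -> #|Q| <= #|Q :&: resolvers x y| + #|B|.
Proof.
by move=> /subset_leq_card leB; rewrite -(cardsID (resolvers x y) Q) leq_add2l.
Qed.

Lemma unresolved1 x y u : x.1.1 != y.1.1 -> x.1.2 = y.1.2 -> x.2 = y.2 ->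
  u \notin resolvers x y -> u.1.1 \in midpoint x.1.1 y.1.1 :\: ends n1.
Proof.
move=> neq e2 e3; rewrite mem_resolvers negbK e2 e3 => /eqP h.
by apply: midpointP => //; lia.
Qed.

Lemma unresolved2 x y u : x.1.1 = y.1.1 -> x.1.2 != y.1.2 -> x.2 = y.2 ->
  u \notin resolvers x y -> u.1.2 \in midpoint x.1.2 y.1.2 :\: ends n2.
Proof.
move=> e1 neq e3; rewrite mem_resolvers negbK e1 e3 => /eqP h.
by apply: midpointP => //; lia.
Qed.

Lemma unresolved3 x y u : x.1.1 = y.1.1 -> x.1.2 = y.1.2 -> x.2 != y.2 ->
  u \notin resolvers x y -> u.2 \in midpoint x.2 y.2 :\: ends n3.
Proof.
move=> e1 e2 neq; rewrite mem_resolvers negbK e1 e2 => /eqP h.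
by apply: midpointP => //; lia.
Qed.

(** * Upper bound in (1): skeletons *)

(* The skeleton consists of the corners of the box and, on each of the four edges
   parallel to axis i, the first ai inner vertices. *)
Section Skeleton.
Variables a1 a2 a3 : nat.
Hypotheses (a1_le : a1 <= n1 - 2) (a2_le : a2 <= n2 - 2) (a3_le : a3 <= n3 - 2).

Definition skeleton : {set V} :=
  setX (setX (ends n1 :|: inner_upto n1 a1) (ends n2)) (ends n3) :|:
  (setX (setX (ends n1) (inner_upto n2 a2)) (ends n3) :|:
   setX (setX (ends n1) (ends n2)) (inner_upto n3 a3)).

(** The first box also carries the eight corners, so the three boxes are disjoint; each axis has
    four parallel edges. *)
Lemma card_skeleton : #|skeleton| = 4 * (a1 + a2 + a3 + 2).
Proof.
have disj n a : [disjoint ends n & inner_upto n a].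
  by rewrite disjoint_sym; apply/pred0P => i /=; rewrite !inE; lia.
rewrite /skeleton !cardsU !cardsX cardsU (disjoint_setI0 (disj _ _)) cards0.
rewrite !card_inner_upto // !card_ends //.
set I1 := _ :&: (_ :|: _); set I2 := _ :&: _.
have -> : I1 = set0.
  apply/setP => -[[a b] c]; rewrite /I1 in_set0 !inE /=; lia.
have -> : I2 = set0.
  apply/setP => -[[a b] c]; rewrite /I2 in_set0 !inE /=; lia.
rewrite !cards0; lia.
Qed.

Lemma skeleton_flip_closed : flip_closed skeleton.
Proof.
have flip_inner n a i : i \in inner_upto n a -> flip i = i.
  by move=> /inner_uptoN /negPf iE; rewrite /flip iE.
move=> [[a b] c]; rewrite /flip1 /flip2 /flip3 /skeleton.
rewrite ![_ \in _ :|: _]in_setU !in_setX /= ![_ \in _ :|: _]in_setU.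
case/or3P => /andP[/andP[]]; first case/orP; move=> ha hb hc;
  rewrite ?(flip_inner _ _ _ ha) ?(flip_inner _ _ _ hb) ?(flip_inner _ _ _ hc);
  by rewrite ?flip_ends ha hb hc ?orbT.
Qed.

(** At least half of the skeleton resolves each pair. A skeleton vertex is at an end of at least two
    axes, so the flip argument covers pairs that differ on two or three axes. For a single axis, the
    exceptions lie in one inner layer, which meets only the four edges parallel to that axis. *)
Lemma card_skeleton_resolvers x y : x != y ->
  2 * (a1 + a2 + a3 + 2) <= #|skeleton :&: resolvers x y|.
Proof.
move=> neq_xy.
have skel_ends u : u \in skeleton ->
    [/\ (u.1.1 \in ends n1) || (u.1.2 \in ends n2),
        (u.1.1 \in ends n1) || (u.2 \in ends n3) &
        (u.1.2 \in ends n2) || (u.2 \in ends n3)].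
  rewrite /skeleton ![_ \in _ :|: _]in_setU !mem_setX3.
  by case/or3P => /andP[/andP[h1 h2] h3]; rewrite ?h1 ?h2 ?h3 ?orbT.
have multi : 1 < (x.1.1 != y.1.1) + (x.1.2 != y.1.2) + (x.2 != y.2) ->
    #|skeleton| <= 2 * #|skeleton :&: resolvers x y|.
  move=> h; apply: flip_closed_resolvers skeleton_flip_closed _ => u /skel_ends.
  by case; move: h; do 3!case: eqP => _ //=; case: (_ \in _); case: (_ \in _).
(* Four exceptions are at most half of the skeleton, which contains the eight corners. *)
have single B : #|B| <= 4 -> skeleton :\: resolvers x y \subset B ->
    #|skeleton| <= 2 * #|skeleton :&: resolvers x y|.
  by move=> B4 /leq_card_resolvers; move: B4 card_skeleton; lia.
suff ? : #|skeleton| <= 2 * #|skeleton :&: resolvers x y|.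
  by rewrite -(leq_pmul2l (isT : 0 < 2)); move: card_skeleton; lia.
move: neq_xy; rewrite eq_vertex.
case: (eqVneq x.1.1 y.1.1) => e1; case: (eqVneq x.1.2 y.1.2) => e2;
  case: (eqVneq x.2 y.2) => e3 //= _;
  try by apply: multi; rewrite ?e1 ?e2 ?e3 ?eqxx.
- apply: (single (setX (setX (ends n1) (ends n2)) (midpoint x.2 y.2))).
    rewrite card_setX3 !card_ends //; have := card_midpoint x.2 y.2; lia.
  apply/subsetP => u /setDP[/skel_ends[_ h2 h3] /(unresolved3 e1 e2 e3)].
  by case/setDP=> mu /negPf uE; move: h2 h3; rewrite !mem_setX3 mu uE !orbF => -> ->.
- apply: (single (setX (setX (ends n1) (midpoint x.1.2 y.1.2)) (ends n3))).
    rewrite card_setX3 !card_ends //; have := card_midpoint x.1.2 y.1.2; lia.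
  apply/subsetP => u /setDP[/skel_ends[h1 _ h3] /(unresolved2 e1 e2 e3)].
  by case/setDP=> mu /negPf uE; move: h1 h3;
    rewrite !mem_setX3 mu uE orbF orFb => -> ->.
apply: (single (setX (setX (midpoint x.1.1 y.1.1) (ends n2)) (ends n3))).
  rewrite card_setX3 !card_ends //; have := card_midpoint x.1.1 y.1.1; lia.
apply/subsetP => u /setDP[/skel_ends[h1 h2 _] /(unresolved1 e1 e2 e3)].
by case/setDP=> mu /negPf uE; move: h1 h2; rewrite !mem_setX3 mu uE => /= -> ->.
Qed.

End Skeleton.

Lemma skeleton_dim K : 2 < K <= 2 * (n1 + n2 + n3) - 8 ->
  exists2 S : {set V}, k_resolving (@grid3 n1 n2 n3) K S & #|S| = 2 * K + odd K.
Proof.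
(* A skeleton with [q] inner vertices per class of four guarantees [2 * (q + 2)] resolvers, so [K]
   is rounded up to an even number. As [2 < K], the subtraction is not truncated. *)
move=> K_range; pose q := (K + odd K)./2 - 2.
have def_K : K + odd K = 2 * (q + 2) by rewrite /q; lia.
have [a1 [a2 [a3 [a1_le a2_le a3_le sum_a]]]] : exists a1 a2 a3,
    [/\ a1 <= n1 - 2, a2 <= n2 - 2, a3 <= n3 - 2 & a1 + a2 + a3 = q].
  (* Axes 1 and 2 are filled first; the upper bound on [K] makes the rest fit on axis 3. *)
  exists (minn q (n1 - 2)), (minn (q - (n1 - 2)) (n2 - 2)).
  exists (q - (n1 - 2) - (n2 - 2)); rewrite /q; split; lia.
pose S := skeleton a1 a2 a3.
have card_S : #|S| = 4 * (q + 2) by rewrite card_skeleton // sum_a.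
(* For odd [K] the rounding leaves one resolver to spare, so one vertex can be removed. *)
have [D D_sub card_D] : exists2 D : {set V}, D \subset S & #|D| = odd K.
  have /card_gt0P[v vS] : 0 < #|S| by rewrite card_S; lia.
  case: (odd K); last by exists set0; rewrite ?sub0set ?cards0.
  by exists [set v]; rewrite ?sub1set ?cards1.
exists (S :\: D); last by rewrite cardsDS // card_S card_D; lia.
apply/k_resolvingP => x y /(card_skeleton_resolvers a1_le a2_le a3_le).
rewrite sum_a -/S setIDAC => geR.
have := cardsID D (S :&: resolvers x y).
have : #|S :&: resolvers x y :&: D| <= #|D| by rewrite subset_leq_card ?subsetIr.
by rewrite card_D; lia.
Qed.

(** * Upper bound in (2): the surface and its meshes *)

Definition mesh12 : {set V} := [set u : V | (u.1.1 \in ends n1) || (u.1.2 \in ends n2)].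
Definition mesh13 : {set V} := [set u : V | (u.1.1 \in ends n1) || (u.2 \in ends n3)].
Definition mesh23 : {set V} := [set u : V | (u.1.2 \in ends n2) || (u.2 \in ends n3)].
Definition surface : {set V} := ~: setX (setX (~: ends n1) (~: ends n2)) (~: ends n3).

Lemma in_surface u : (u \in surface) =
  [|| u.1.1 \in ends n1, u.1.2 \in ends n2 | u.2 \in ends n3].
Proof. by rewrite in_setC mem_setX3 !in_setC !negb_and !negbK orbA. Qed.

Lemma card_surface :
  #|surface| = n1 * n2 * n3 - (n1 - 2) * (n2 - 2) * (n3 - 2).
Proof. by rewrite cardsCs setCK card_setX3 !card_inner // !card_prod !card_ord. Qed.

(** The mesh consists of [n3] copies of the boundary of an [n1] by [n2] rectangle. *)
Lemma card_mesh12 : #|mesh12| = 2 * (n3 * (n1 + n2 - 2)).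
Proof.
have -> : mesh12 = ~: setX (setX (~: ends n1) (~: ends n2)) setT.
  apply/setP => u; rewrite in_setC mem_setX3 inE !in_setC in_setT.
  by rewrite ?andbT ?negb_and ?negbK.
rewrite cardsCs setCK card_setX3 !card_inner // cardsT !card_prod !card_ord.
exact: card_mesh_arith.
Qed.

Lemma card_mesh13 : #|mesh13| = 2 * (n2 * (n1 + n3 - 2)).
Proof.
have -> : mesh13 = ~: setX (setX (~: ends n1) setT) (~: ends n3).
  apply/setP => u; rewrite in_setC mem_setX3 inE !in_setC in_setT.
  by rewrite ?andbT ?negb_and ?negbK.
rewrite cardsCs setCK card_setX3 !card_inner // cardsT !card_prod !card_ord.
by rewrite mulnAC [(_ - _) * _ * _]mulnAC card_mesh_arith.
Qed.

Lemma card_mesh23 : #|mesh23| = 2 * (n1 * (n2 + n3 - 2)).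
Proof.
have -> : mesh23 = ~: setX (setX setT (~: ends n2)) (~: ends n3).
  apply/setP => u; rewrite in_setC mem_setX3 inE !in_setC in_setT.
  by rewrite ?andbT ?negb_and ?negbK.
rewrite cardsCs setCK card_setX3 !card_inner // cardsT !card_prod !card_ord.
by rewrite -mulnA mulnC -[n1 * _ * _]mulnA [n1 * (_ * _)]mulnC card_mesh_arith.
Qed.

(** This is half the size of the smallest of the three meshes. *)
Definition alpha_M := minn (n1 * (n2 + n3 - 2))
  (minn (n2 * (n1 + n3 - 2)) (n3 * (n1 + n2 - 2))).

(** For each pair some mesh has at least half of its vertices resolving. If the pair differs on two
    axes, the flip argument applies to the mesh of these axes. If it differs on one axis only, a
    mesh involving that axis is used and the exceptions are counted. *)
Lemma surface_resolving : k_resolving (@grid3 n1 n2 n3) alpha_M surface.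
Proof.
apply/k_resolvingP => x y; rewrite eq_vertex => neq.
have from_mesh Q m : Q \subset surface -> alpha_M <= m -> #|Q| = 2 * m ->
    #|Q| <= 2 * #|Q :&: resolvers x y| -> alpha_M <= #|surface :&: resolvers x y|.
  move=> Qs le_m -> ; rewrite leq_pmul2l // => le_mR.
  apply: leq_trans le_m (leq_trans le_mR _).
  by apply/subset_leq_card/setSI.
have from12 : #|mesh12| <= 2 * #|mesh12 :&: resolvers x y| ->
    alpha_M <= #|surface :&: resolvers x y|.
  apply: from_mesh _ card_mesh12; last by rewrite /alpha_M; lia.
  by apply/subsetP => u; rewrite inE in_surface => /orP[] ->; rewrite ?orbT.
have from13 : #|mesh13| <= 2 * #|mesh13 :&: resolvers x y| ->
    alpha_M <= #|surface :&: resolvers x y|.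
  apply: from_mesh _ card_mesh13; last by rewrite /alpha_M; lia.
  by apply/subsetP => u; rewrite inE in_surface => /orP[] ->; rewrite ?orbT.
have from23 : #|mesh23| <= 2 * #|mesh23 :&: resolvers x y| ->
    alpha_M <= #|surface :&: resolvers x y|.
  apply: from_mesh _ card_mesh23; last by rewrite /alpha_M; lia.
  by apply/subsetP => u; rewrite inE in_surface => /orP[] ->; rewrite ?orbT.
have cl12 : flip_closed mesh12.
  by move=> u; rewrite ![_ \in mesh12]inE /= !flip_ends.
have cl13 : flip_closed mesh13.
  by move=> u; rewrite ![_ \in mesh13]inE /= !flip_ends.
have cl23 : flip_closed mesh23.
  by move=> u; rewrite ![_ \in mesh23]inE /= !flip_ends.
move: neq.
case: (eqVneq x.1.1 y.1.1) => e1; case: (eqVneq x.1.2 y.1.2) => e2;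
  case: (eqVneq x.2 y.2) => e3 //= _.
(* The exceptions lie on two lines of [n2] vertices, at most half of the mesh because [n1 + n3 - 2]
   is at least 2. *)
- apply: from13; suff /leq_card_resolvers : mesh13 :\: resolvers x y \subset
      setX (setX (ends n1) setT) (midpoint x.2 y.2).
    rewrite card_mesh13 card_setX3 card_ends // cardsT card_ord.
    have := card_midpoint x.2 y.2; nia.
  apply/subsetP => u /setDP[uQ /(unresolved3 e1 e2 e3)/setDP[mu /negPf uE]].
  by move: uQ; rewrite [u \in _]inE uE !mem_setX3 mu in_setT orbF => ->.
- apply: from12; suff /leq_card_resolvers : mesh12 :\: resolvers x y \subset
      setX (setX (ends n1) (midpoint x.1.2 y.1.2)) setT.
    rewrite card_mesh12 card_setX3 card_ends // cardsT card_ord.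
    have := card_midpoint x.1.2 y.1.2; nia.
  apply/subsetP => u /setDP[uQ /(unresolved2 e1 e2 e3)/setDP[mu /negPf uE]].
  by move: uQ; rewrite [u \in _]inE uE !mem_setX3 mu in_setT orbF => ->.
- apply/from23/flip_closed_resolvers => // u.
  by rewrite inE e2 e3 orbC => /orP[] ->; rewrite ?orbT.
- apply: from12; suff /leq_card_resolvers : mesh12 :\: resolvers x y \subset
      setX (setX (midpoint x.1.1 y.1.1) (ends n2)) setT.
    rewrite card_mesh12 card_setX3 card_ends // cardsT card_ord.
    have := card_midpoint x.1.1 y.1.1; nia.
  apply/subsetP => u /setDP[uQ /(unresolved1 e1 e2 e3)/setDP[mu /negPf uE]].
  by move: uQ; rewrite [u \in _]inE uE !mem_setX3 mu in_setT => /= ->.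
- apply/from13/flip_closed_resolvers => // u.
  by rewrite inE e1 e3 => /orP[] ->; rewrite ?orbT.
- apply/from12/flip_closed_resolvers => // u.
  by rewrite inE e1 e2 => /orP[] ->; rewrite ?orbT.
apply/from12/flip_closed_resolvers => // u.
by rewrite inE e1 e2 => /orP[] ->; rewrite ?orbT.
Qed.

(** * Lower bounds from the diagonals of unit squares *)

Definition differ12 : {set V} :=
  [set u : V | (u.1.1 == 0 :> nat) != (u.1.2 == 0 :> nat)].
Definition differ13 : {set V} :=
  [set u : V | (u.1.1 == 0 :> nat) != (u.2 == 0 :> nat)].
Definition differ23 : {set V} :=
  [set u : V | (u.1.2 == 0 :> nat) != (u.2 == 0 :> nat)].

Lemma k_resolving_split k S (D : {set V}) (x y x' y' : V) :
  x != y -> x' != y' ->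
  resolvers x y \subset D -> resolvers x' y' \subset ~: D ->
  k_resolving (@grid3 n1 n2 n3) k S -> k <= #|S :&: D| /\ k <= #|S :\: D|.
Proof.
move=> neq neq' RD RD' /k_resolvingP kS; rewrite setDE.
by split; [apply: leq_trans (kS _ _ neq) _ | apply: leq_trans (kS _ _ neq') _];
  apply/subset_leq_card/setIS.
Qed.

Let o1 : 'I_n1 := Ordinal (ltnW n1_ge2).
Let o2 : 'I_n2 := Ordinal (ltnW n2_ge2).
Let o3 : 'I_n3 := Ordinal (ltnW n3_ge2).
Let i1 : 'I_n1 := Ordinal n1_ge2.
Let i2 : 'I_n2 := Ordinal n2_ge2.
Let i3 : 'I_n3 := Ordinal n3_ge2.

(** A step from 0 to 1 on an axis changes the distance to [u] by 1, upwards iff the coordinate of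
    [u] is zero. Along a diagonal two such changes either cancel or add up. *)
Lemma differ12P k S : k_resolving (@grid3 n1 n2 n3) k S ->
  k <= #|S :&: differ12| /\ k <= #|S :\: differ12|.
Proof.
apply: (@k_resolving_split _ _ _ (o1, i2, o3) (i1, o2, o3) (o1, o2, o3) (i1, i2, o3));
  rewrite ?eq_vertex //; apply/subsetP => u;
  rewrite mem_resolvers !inE /absdiff /=; lia.
Qed.

Lemma differ13P k S : k_resolving (@grid3 n1 n2 n3) k S ->
  k <= #|S :&: differ13| /\ k <= #|S :\: differ13|.
Proof.
apply: (@k_resolving_split _ _ _ (o1, o2, i3) (i1, o2, o3) (o1, o2, o3) (i1, o2, i3));
  rewrite ?eq_vertex //; apply/subsetP => u;
  rewrite mem_resolvers !inE /absdiff /=; lia.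
Qed.

Lemma differ23P k S : k_resolving (@grid3 n1 n2 n3) k S ->
  k <= #|S :&: differ23| /\ k <= #|S :\: differ23|.
Proof.
apply: (@k_resolving_split _ _ _ (o1, o2, i3) (o1, i2, o3) (o1, o2, o3) (o1, i2, i3));
  rewrite ?eq_vertex //; apply/subsetP => u;
  rewrite mem_resolvers !inE /absdiff /=; lia.
Qed.

Lemma k_resolving_card k S :
  k_resolving (@grid3 n1 n2 n3) k S -> 2 * k + odd k <= #|S|.
Proof.
move=> kS; apply: (@halved_card _ S differ12 differ13 differ23).
(* Whether coordinates 2 and 3 differ in being zero is the exclusive or of the comparisons of each
   with coordinate 1. *)
- by move=> u; rewrite !inE; do 3!case: (_ == 0).
- exact: differ12P.
- exact: differ13P.
- exact: differ23P.
Qed.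

Lemma card_differ12 : #|differ12| <= n3 * (n1 + n2 - 2).
Proof.
have sub : differ12 \subset
    setX (setX [set o1] [set~ o2]) setT :|: setX (setX [set~ o1] [set o2]) setT.
  apply/subsetP => u; rewrite in_setU !mem_setX3 !inE -!val_eqE /=.
  by do 2!case: (_ == 0).
apply: leq_trans (subset_leq_card sub) (leq_trans (leq_card_setU _ _) _).
by rewrite !card_setX3 !cards1 !cardsC1 !cardsT !card_ord; nia.
Qed.

Lemma card_differ13 : #|differ13| <= n2 * (n1 + n3 - 2).
Proof.
have sub : differ13 \subset
    setX (setX [set o1] setT) [set~ o3] :|: setX (setX [set~ o1] setT) [set o3].
  apply/subsetP => u; rewrite in_setU !mem_setX3 !inE -!val_eqE /=.
  by do 2!case: (_ == 0).
apply: leq_trans (subset_leq_card sub) (leq_trans (leq_card_setU _ _) _).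
by rewrite !card_setX3 !cards1 !cardsC1 !cardsT !card_ord; nia.
Qed.

Lemma card_differ23 : #|differ23| <= n1 * (n2 + n3 - 2).
Proof.
have sub : differ23 \subset
    setX (setX setT [set o2]) [set~ o3] :|: setX (setX setT [set~ o2]) [set o3].
  apply/subsetP => u; rewrite in_setU !mem_setX3 !inE -!val_eqE /=.
  by do 2!case: (_ == 0).
apply: leq_trans (subset_leq_card sub) (leq_trans (leq_card_setU _ _) _).
by rewrite !card_setX3 !cards1 !cardsC1 !cardsT !card_ord; nia.
Qed.

Lemma k_resolving_alpha_M k S : k_resolving (@grid3 n1 n2 n3) k S -> k <= alpha_M.
Proof.
move=> kS; rewrite /alpha_M !leq_min; apply/and3P; split.
- apply: leq_trans (proj1 (differ23P kS)) (leq_trans _ card_differ23).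
  exact/subset_leq_card/subsetIr.
- apply: leq_trans (proj1 (differ13P kS)) (leq_trans _ card_differ13).
  exact/subset_leq_card/subsetIr.
apply: leq_trans (proj1 (differ12P kS)) (leq_trans _ card_differ12).
exact/subset_leq_card/subsetIr.
Qed.

End Grid.

(** * Existence of the minimum, and the three ranges of [k] *)

Lemma k_dim_exists (T : finType) (e : rel T) k S :
  k_resolving e k S -> exists2 d, k_dim_is e k d & d <= #|S|.
Proof.
(* A boolean form of [k_resolving], over which [arg_minnP] can minimize. *)
move=> kS; pose P (A : {set T}) :=
  [forall x, forall y, (x != y) ==>
     (k <= #|[set u in A | gdist e x u != gdist e y u]|)].
have PP A : reflect (k_resolving e k A) (P A).
  apply: (iffP forallP) => [h x y neq|h x].
    by have /forallP/(_ y)/implyP := h x; apply.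
  by apply/forallP => y; apply/implyP; apply: h.
have [A /PP kA minA] := arg_minnP (fun A : {set T} => #|A|) (introT (PP S) kS).
exists #|A|; last by apply: minA; apply/PP.
by split=> [|B /PP kB]; [exists A | apply: minA].
Qed.

Theorem theorem19 (k n1 n2 n3 : nat)
  (hk : 2 <= k) (hn1 : 2 <= n1) (hn2 : 2 <= n2) (hn3 : 2 <= n3) :
  let G := @grid3 n1 n2 n3 in
  let alpha_m := 2 * (n1 + n2 + n3) - 8 in
  let alpha_M := minn (n1 * (n2 + n3 - 2))
                   (minn (n2 * (n1 + n3 - 2)) (n3 * (n1 + n2 - 2))) in
  [/\ 2 <= k < alpha_m ->
        (odd k -> k_dim_is G k.+1 (2 * k + 2)) /\
        (~~ odd k -> k_dim_is G k.+1 (2 * k + 3)),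
      alpha_m <= k < alpha_M ->
        (exists S, k_resolving G k.+1 S) /\
        (exists2 d, k_dim_is G k.+1 d &
           d <= n1 * n2 * n3 - (n1 - 2) * (n2 - 2) * (n3 - 2)) &
      alpha_M <= k -> ~ (exists S, k_resolving G k.+1 S)].
Proof.
move=> G am aM; split=> [k_range|k_range|le_k [S /k_resolving_alpha_M]].
- have k1_range : 2 < k.+1 <= am by lia.
  (* One formula for both parities: it equals [2 * k + 2] for odd [k] and [2 * k + 3] for even
     [k]. *)
  have dimP : k_dim_is G k.+1 (2 * k.+1 + odd k.+1).
    by split=> [|S]; [apply: skeleton_dim | apply: k_resolving_card].
  by split=> [ok|/negPf ok]; move: dimP; rewrite /= ok mulnS addnC addnA addnC.
- have kS : k_resolving G k.+1 (surface n1 n2 n3).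
    move=> x y /(surface_resolving hn1 hn2 hn3); apply: leq_trans.
    by case/andP: k_range.
  split; first by exists (surface n1 n2 n3).
  by rewrite -card_surface //; apply: k_dim_exists.
by move=> /(_ hn1 hn2 hn3); rewrite leqNgt ltnS le_k.
Qed.
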